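(* Let $\mathcal{R}$ be a left-linear TRS and $\mathcal{C}\subseteq\mathcal{R}$ a confluent TRS, and let $\mathcal{P}=\mathsf{PCPS}(\mathcal{R},\mathcal{C})$. If every parallel critical pair $(t,u)$ between $\mathcal{R}$ and $\mathcal{R}$ satisfies $t\to^*_\mathcal{R}\cdot{}_\mathcal{R}\!\!\leftarrow^*u$ and $\mathcal{P}/\mathcal{R}$ is terminating, then $\mathcal{R}$ is confluent.
   Context: A TRS is a set of rules $\ell\to r$ ($\ell\notin\mathcal{V}$, $\mathcal{V}ar(r)\subseteq\mathcal{V}ar(\ell)$); left-linear: no variable repeated in a left-hand side; confluent: ${}_\mathcal{R}\!\!\leftarrow^*\cdot\to_\mathcal{R}^*\subseteq\to_\mathcal{R}^*\cdot{}_\mathcal{R}\!\!\leftarrow^*$. $\mathcal{P}/\mathcal{R}$ is terminating if the relation $\to_\mathcal{R}^*\cdot\to_\mathcal{P}\cdot\to_\mathcal{R}^*$ admits no infinite chain. $\leftrightarrow^*_\mathcal{C}$ is the conversion relation of $\mathcal{C}$. Parallel critical peak between $\mathcal{R}$ and $\mathcal{R}$: for variants $\ell\to r$ and $\ell_p\to r_p$ ($p\in P$) of $\mathcal{R}$-rules, all pairwise variable-disjoint, where $P$ is a non-empty set of pairwise parallel (no one a prefix of another) function-symbol positions of $\ell$, $\sigma$ a most general unifier of $\{\ell_p\approx\ell|_p\}_{p\in P}$, and $\ell_\epsilon\to r_\epsilon$ not a variant of $\ell\to r$ if $P=\{\epsilon\}$ (root): the peak with source $s=\ell\sigma$, left result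 $t=(\ell\sigma)[r_p\sigma]_{p\in P}$ and right result $u=r\sigma$; $(t,u)$ is a parallel critical pair. $\mathsf{PCPS}(\mathcal{R},\mathcal{C})$ is the TRS consisting of the rules $s\to t$ and $s\to u$ for every such parallel critical peak $(t,s,u)$ for which $t\leftrightarrow^*_\mathcal{C}u$ does not hold. *)

(* Defs.v *)
From Stdlib Require Import List Relations.
Import ListNotations.
Set Implicit Arguments.

Section TRS.
Variable F : Type.  (* function symbols; variables are nat (infinite supply) *)

Inductive term : Type :=
| Var : nat -> term
| Fun : F -> list term -> term.

Definition subst_t := nat -> term.

Fixpoint subst (s : subst_t) (t : term) : term :=
  match t with
  | Var x => s x
  | Fun f ts => Fun f (map (subst s) ts)
  end.

Fixpoint vars (t : term) : list nat :=
  match t with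
  | Var x => [x]
  | Fun _ ts => flat_map vars ts
  end.

Definition pos := list nat.

Fixpoint subt (t : term) (p : pos) : option term :=
  match p with
  | [] => Some t
  | i :: q =>
      match t with
      | Var _ => None
      | Fun _ ts => match nth_error ts i with
                    | Some ti => subt ti q
                    | None => None
                    end
      end
  end.

Fixpoint upd_nth (A : Type) (g : A -> A) (i : nat) (l : list A) : list A :=
  match l, i with
  | [], _ => []
  | a :: l', 0 => g a :: l'
  | a :: l', S j => a :: upd_nth g j l'
  end.

Fixpoint repl (t : term) (p : pos) (s : term) {struct p} : term :=
  match p with
  | [] => s
  | i :: q =>
      match t with
      | Var x => Var x
      | Fun f ts => Fun f (upd_nth (fun ti => repl ti q s) i ts)
      end
  end.

Definition prefix (p q : pos) : Prop := exists r, q = p ++ r.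
Definition parallel (p q : pos) : Prop := ~ prefix p q /\ ~ prefix q p.
Definition fun_pos (t : term) (p : pos) : Prop :=
  exists f ts, subt t p = Some (Fun f ts).

(* a TRS is a (possibly infinite) set of rules l -> r *)
Definition trs := term -> term -> Prop.

Definition is_trs (R : trs) : Prop :=
  forall l r, R l r ->
    (forall x, l <> Var x) /\ (forall x, In x (vars r) -> In x (vars l)).

Definition left_linear (R : trs) : Prop :=
  forall l r, R l r -> NoDup (vars l).

Inductive rstep (R : trs) : term -> term -> Prop :=
| rs_root : forall l r (s : subst_t), R l r -> rstep R (subst s l) (subst s r)
| rs_ctx : forall f ts1 t u ts2, rstep R t u ->
    rstep R (Fun f (ts1 ++ t :: ts2)) (Fun f (ts1 ++ u :: ts2)).

Definition rsteps (R : trs) := clos_refl_trans term (rstep R).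
Definition conv (R : trs) := clos_refl_sym_trans term (rstep R).

Definition joinable (R : trs) (t u : term) : Prop :=
  exists v, rsteps R t v /\ rsteps R u v.

Definition confluent (R : trs) : Prop :=
  forall s t u, rsteps R s t -> rsteps R s u -> joinable R t u.

Definition rel_step (P R : trs) (s t : term) : Prop :=
  exists s' t', rsteps R s s' /\ rstep P s' t' /\ rsteps R t' t.

Definition rel_terminating (P R : trs) : Prop :=
  ~ exists f : nat -> term, forall i, rel_step P R (f i) (f (S i)).

Definition is_variant (l' r' l r : term) : Prop :=
  exists pi pi' : nat -> nat,
    (forall x, pi' (pi x) = x) /\ (forall x, pi (pi' x) = x) /\
    l' = subst (fun x => Var (pi x)) l /\ r' = subst (fun x => Var (pi x)) r.

Definition variant_of (R : trs) (l' r' : term) : Prop :=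
  exists l r, R l r /\ is_variant l' r' l r.

Definition rule_vars (l r : term) : list nat := vars l ++ vars r.

Definition vdisjoint (xs ys : list nat) : Prop :=
  forall x, In x xs -> ~ In x ys.

(* a parallel step description: entries (p, (l_p, r_p)) *)
Definition pentry := (pos * (term * term))%type.

Definition unifies (l : term) (ps : list pentry) (tau : subst_t) : Prop :=
  forall a, In a ps -> forall s, subt l (fst a) = Some s ->
    subst tau (fst (snd a)) = subst tau s.

Definition is_mgu (l : term) (ps : list pentry) (sigma : subst_t) : Prop :=
  unifies l ps sigma /\
  forall tau, unifies l ps tau ->
    exists delta : subst_t, forall x, tau x = subst delta (sigma x).

(* Parallel critical peak (t, s, u) between R and R:
   source s, left result t, right result u. *)
Definition pc_peak (R : trs) (s t u : term) : Prop :=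
  exists (l r : term) (ps : list pentry) (sigma : subst_t),
    variant_of R l r /\
    ps <> [] /\
    NoDup (map fst ps) /\
    (forall a, In a ps ->
       variant_of R (fst (snd a)) (snd (snd a)) /\
       fun_pos l (fst a) /\
       vdisjoint (rule_vars l r) (rule_vars (fst (snd a)) (snd (snd a)))) /\
    (forall a b, In a ps -> In b ps -> a <> b ->
       parallel (fst a) (fst b) /\
       vdisjoint (rule_vars (fst (snd a)) (snd (snd a)))
                 (rule_vars (fst (snd b)) (snd (snd b)))) /\
    is_mgu l ps sigma /\
    (forall le re, ps = [([], (le, re))] -> ~ is_variant le re l r) /\
    s = subst sigma l /\
    u = subst sigma r /\
    t = fold_left (fun acc a => repl acc (fst a) (subst sigma (snd (snd a))))
                  ps (subst sigma l).

Definition PCPS (R C : trs) : trs :=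
  fun s v => exists t u, pc_peak R s t u /\ ~ conv C t u /\ (v = t \/ v = u).

End TRS.

(* Main.v *)
(** Fix a term [a] such that everything properly below it in [P/R] is confluent,
    where [P = PCPS R C].  On the reducts of [a], take as equivalence the
    conversions by [C]-steps and by [R]-steps starting properly below [a]; as [C]
    is confluent, equivalent terms are joinable.  A local peak of parallel steps
    whose left step uses rules [S1] and whose right step uses rules [S2] is closed
    by one parallel [S2]-step on the left and one parallel [S1]-step on the right,
    up to this equivalence: an instance of a parallel critical pair is either
    [C]-convertible, or both of its sides lie properly below [a].  For [S1 = S2 = R]
    this is the diamond property of parallel steps modulo the equivalence, and for
    [S1 = C] it makes the equivalence compatible with parallel steps, so [R] is
    confluent at [a]. *)
Require Import Defs.
From Stdlib Require Import List Relations.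
From Stdlib Require Import Arith Lia Classical ClassicalEpsilon FinFun.
Import ListNotations.

(** * Abstract rewriting *)

Definition joins {A} (B : relation A) (x y : A) : Prop :=
  exists z, clos_refl_trans A B x z /\ clos_refl_trans A B y z.

Lemma clos_rt_lift {A B} (f : A -> B) (P : relation A) (Q : relation B) :
  (forall x y, P x y -> clos_refl_trans B Q (f x) (f y)) ->
  forall x y, clos_refl_trans A P x y -> clos_refl_trans B Q (f x) (f y).
Proof.
  intros H x y HP; induction HP; [auto|apply rt_refl|eapply rt_trans; eauto].
Qed.

Lemma clos_rst_lift {A B} (f : A -> B) (P : relation A) (Q : relation B) :
  (forall x y, P x y -> Q (f x) (f y)) ->
  forall x y, clos_refl_sym_trans A P x y -> clos_refl_sym_trans B Q (f x) (f y).
Proof.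
  intros H x y HP; induction HP;
    [apply rst_step; auto|apply rst_refl|now apply rst_sym|eapply rst_trans; eauto].
Qed.

Lemma church_rosser {A} (B : relation A) :
  (forall x y z, clos_refl_trans A B x y -> clos_refl_trans A B x z -> joins B y z) ->
  forall x y, clos_refl_sym_trans A B x y -> joins B x y.
Proof.
  intros HB x y H; induction H as [x y H|x|x y H [z [H1 H2]]|x y z H [v [H1 H2]] H' [w [H3 H4]]].
  - exists y; split; [now apply rt_step|apply rt_refl].
  - exists x; split; apply rt_refl.
  - exists z; auto.
  - destruct (HB _ _ _ H2 H3) as [k [K1 K2]].
    exists k; split; eapply rt_trans; eauto.
Qed.

Lemma joins_conv {A} (B : relation A) x y : joins B x y -> clos_refl_sym_trans A B x y.
Proof.
  intros [z [H1 H2]]; apply rst_trans with z;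
    [|apply rst_sym]; now apply clos_rt_clos_rst.
Qed.

Lemma diamond_confluent {A} (D : relation A) :
  (forall x y z, D x y -> D x z -> exists w, D y w /\ D z w) ->
  forall x y z, clos_refl_trans A D x y -> clos_refl_trans A D x z -> joins D y z.
Proof.
  intros HD.
  assert (strip : forall x z, clos_refl_trans_1n A D x z -> forall y, D x y ->
    exists w, clos_refl_trans A D y w /\ D z w).
  { induction 1 as [x|x x1 z H H' IH]; intros y Hy.
    - exists y; split; [apply rt_refl|auto].
    - destruct (HD _ _ _ Hy H) as [w [W1 W2]].
      destruct (IH _ W2) as [k [K1 K2]].
      exists k; split; [eapply rt_trans; [apply rt_step|]; eauto|auto]. }
  intros x y z Hy; apply clos_rt_rt1n in Hy; revert z.
  induction Hy as [x|x x1 y H H' IH]; intros z Hz.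
  - exists z; split; [auto|apply rt_refl].
  - apply clos_rt_rt1n in Hz. destruct (strip _ _ Hz _ H) as [w [W1 W2]].
    destruct (IH _ W1) as [k [K1 K2]].
    exists k; split; [auto|eapply rt_trans; [apply rt_step|]; eauto].
Qed.

(* Up to conversion on both ends, [step] has the diamond property on [X]. *)
Lemma confluent_modulo {A} (step base : relation A) (X : A -> Prop) :
  (forall x y, X x -> step x y -> X y) ->
  (forall x y, X x -> base x y -> X y) ->
  (forall x y z, clos_refl_trans A base x y -> clos_refl_trans A base x z -> joins base y z) ->
  (forall x y z, X x -> step x y -> step x z ->
     exists y' z', step y y' /\ step z z' /\ clos_refl_sym_trans A base y' z') ->
  (forall x y z, X x -> base x y -> step x z ->
     exists y', step y y' /\ clos_refl_sym_trans A base y' z) ->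
  forall x y z, X x -> clos_refl_trans A step x y -> clos_refl_trans A step x z ->
    joins (union A step base) y z.
Proof.
  intros X_step X_base base_confluent step_peak base_peak.
  set (eqv := clos_refl_sym_trans A base) in *.
  assert (CR := church_rosser base base_confluent).
  assert (X_bs : forall x y, X x -> clos_refl_trans A base x y -> X y).
  { intros x y HX H; induction H; eauto. }
  (* A single [step] is carried along a [base] reduction, one [base] step at a time; the conversions
     between the results compose. *)
  assert (bs_peak : forall x y, clos_refl_trans_1n A base x y -> forall z, X x -> step x z ->
    exists y', step y y' /\ eqv y' z).
  { induction 1 as [x|x x1 y H H' IH]; intros z HX Hz.
    - exists z; split; [auto|apply rst_refl].
    - destruct (base_peak _ _ _ HX H Hz) as [z1 [K1 K2]].
      destruct (IH z1) as [y' [L1 L2]]; eauto.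
      exists y'; split; [auto|eapply rst_trans; eauto]. }
  (* [D] is [step] with conversions absorbed at both ends, so the diamond property modulo [eqv]
     becomes a plain one. [X] is recorded also for the inner source [x'], since peaks can be closed
     only inside [X]. *)
  set (D := fun x y => X x /\ X y /\ exists x' y', X x' /\ eqv x x' /\ step x' y' /\ eqv y' y).
  assert (HD : forall x y z, D x y -> D x z -> exists w, D y w /\ D z w).
  { intros x y z [Xx [Xy [x1 [y1 [Xx1 [E1 [S1 E1']]]]]]]
                 [_ [Xz [x2 [z1 [Xx2 [E2 [S2 E2']]]]]]].
    (* The two steps may start at different, merely convertible sources. Carrying both to a common
       [base] reduct [v] gives a genuine peak. *)
    destruct (CR x1 x2) as [v [V1 V2]].
    { eapply rst_trans; [apply rst_sym|]; eauto. }
    destruct (bs_peak x1 v (clos_rt_rt1n _ _ _ _ V1) y1) as [y2 [Y1 Y2]]; auto.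
    destruct (bs_peak x2 v (clos_rt_rt1n _ _ _ _ V2) z1) as [z2 [Z1 Z2]]; auto.
    assert (Xv : X v) by eauto.
    destruct (step_peak v y2 z2) as [w [w' [W [W' E]]]]; auto.
    assert (X y2) by eauto. assert (X z2) by eauto. assert (X w) by eauto.
    exists w; split; (split; [assumption|split; [assumption|]]).
    - exists y2, w; repeat split; auto; [|apply rst_refl].
      eapply rst_trans; apply rst_sym; eauto.
    - exists z2, w'; repeat split; auto; [|now apply rst_sym].
      eapply rst_trans; apply rst_sym; eauto. }
  assert (X_steps : forall x y, clos_refl_trans A step x y -> X x -> clos_refl_trans A D x y).
  { intros x y H HX. apply clos_rt_rt1n in H.
    induction H as [x|x x1 y H H' IH]; [apply rt_refl|].
    apply rt_trans with x1; [apply rt_step|eauto].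
    split; [auto|split; [eauto|]]. exists x, x1; repeat split; auto; apply rst_refl. }
  set (red := clos_refl_trans A (union A step base)).
  assert (bs_red : forall x y, clos_refl_trans A base x y -> red x y).
  { intros x y; apply (clos_rt_lift (fun x => x)); intros; apply rt_step; now right. }
  (* A [D] sequence may follow conversions backwards. Joining the term reached so far with the
     source of the next step, and carrying the step there, yields a real reduction, up to [eqv] at
     its end. *)
  assert (D_red : forall x y, clos_refl_trans_n1 A D x y -> X x ->
    exists y', red x y' /\ X y' /\ eqv y' y).
  { induction 1 as [|y z [Xy [Xz [y1 [z1 [Xy1 [E1 [S1 E2]]]]]]] H IH]; intros HX.
    - exists x; repeat split; auto; [apply rt_refl|apply rst_refl].
    - destruct (IH HX) as [y' [R1 [Xy' E]]].
      destruct (CR y' y1) as [v [V1 V2]]; [eapply rst_trans; eauto|].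
      destruct (bs_peak y1 v (clos_rt_rt1n _ _ _ _ V2) z1) as [k [K1 K2]]; auto.
      exists k; split; [|split].
      + eapply rt_trans; [exact R1|]. eapply rt_trans; [apply bs_red; exact V1|].
        apply rt_step; now left.
      + eauto.
      + eapply rst_trans; eauto. }
  intros x y z HX Hy Hz.
  destruct (diamond_confluent D HD x y z) as [w [W1 W2]]; auto.
  assert (HXy : X y) by (clear -Hy HX X_step; induction Hy; eauto).
  assert (HXz : X z) by (clear -Hz HX X_step; induction Hz; eauto).
  destruct (D_red y w (clos_rt_rtn1 _ _ _ _ W1) HXy) as [y' [Y1 [_ Y2]]].
  destruct (D_red z w (clos_rt_rtn1 _ _ _ _ W2) HXz) as [z' [Z1 [_ Z2]]].
  destruct (CR y' z') as [k [K1 K2]]; [eapply rst_trans; [|apply rst_sym]; eauto|].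
  exists k; split; eapply rt_trans; eauto; now apply bs_red.
Qed.

(** Classically, an element that is not accessible has a successor that is not accessible; choosing
    one again and again builds an infinite chain. *)
Lemma no_chain_Acc {A} (Q : relation A) :
  ~ (exists f : nat -> A, forall i, Q (f i) (f (S i))) ->
  forall a, Acc (fun y x => Q x y) a.
Proof.
  intros H a; apply NNPP; intros Ha; apply H.
  set (T := {x | ~ Acc (fun y x => Q x y) x}).
  assert (next : forall x : T, {y : T | Q (proj1_sig x) (proj1_sig y)}).
  { intros [x Hx]; apply constructive_indefinite_description.
    apply NNPP; intros Hn; apply Hx; constructor; intros y Hy.
    apply NNPP; intros Hy'; apply Hn; now exists (exist _ y Hy'). }
  set (f := fix f n : T := match n with 0 => exist _ a Ha | S n => proj1_sig (next (f n)) end).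
  exists (fun n => proj1_sig (f n)); intros i; exact (proj2_sig (next (f i))).
Qed.

(** * Terms and substitutions *)

(** Arguments are nested in a list, so their induction hypotheses come as a [Forall]. *)
Lemma term_args_ind {F} (P : term F -> Prop) :
  (forall x, P (Var F x)) -> (forall f ts, Forall P ts -> P (Fun f ts)) -> forall t, P t.
Proof.
  intros HV HF. fix IH 1. intros [x|f ts]; [apply HV|apply HF].
  induction ts as [|t ts IHts]; constructor; [apply IH|exact IHts].
Qed.

Lemma subst_ext {F} (s s' : subst_t F) t :
  (forall x, In x (vars t) -> s x = s' x) -> subst s t = subst s' t.
Proof.
  induction t as [x|f ts IH] using term_args_ind; simpl; intros H; [auto|].
  f_equal; apply map_ext_in; intros a Ha. rewrite Forall_forall in IH.
  apply IH; auto. intros x Hx; apply H, in_flat_map; eauto.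
Qed.

(** Uniqueness of matching. It makes the contracta agree when a rule overlaps a variant of itself at
    the root. *)
Lemma subst_ext_inv {F} (s s' : subst_t F) t :
  subst s t = subst s' t -> forall x, In x (vars t) -> s x = s' x.
Proof.
  induction t as [y|f ts IH] using term_args_ind; simpl; intros H x Hx.
  - now destruct Hx as [->|[]].
  - injection H as H. apply in_flat_map in Hx as [a [Ha Hx]].
    rewrite Forall_forall in IH. apply (IH a); auto.
    now apply (ext_in_map H).
Qed.

Lemma subst_subst {F} (s s' : subst_t F) t :
  subst s (subst s' t) = subst (fun x => subst s (s' x)) t.
Proof.
  induction t as [x|f ts IH] using term_args_ind; simpl; [auto|].
  f_equal. rewrite map_map. apply map_ext_in. now apply Forall_forall.
Qed.

Lemma subst_Var {F} (t : term F) : subst (fun x => Var F x) t = t.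
Proof.
  induction t as [x|f ts IH] using term_args_ind; simpl; [auto|].
  f_equal. rewrite <- (map_id ts) at 2. apply map_ext_in. now apply Forall_forall.
Qed.

Lemma vars_rename {F} (h : nat -> nat) (t : term F) :
  vars (subst (fun x => Var F (h x)) t) = map h (vars t).
Proof.
  induction t as [x|f ts IH] using term_args_ind; simpl; [auto|].
  induction IH as [|t ts Ht _ IHts]; simpl; [auto|].
  now rewrite map_app, Ht, IHts.
Qed.

Lemma map_subst_ext {F} (s s' : subst_t F) ts :
  (forall x, In x (flat_map (@vars F) ts) -> s x = s' x) -> map (subst s) ts = map (subst s') ts.
Proof.
  intros H; apply map_ext_in; intros t Ht; apply subst_ext; intros x Hx.
  apply H, in_flat_map; eauto.
Qed.

Lemma subt_subst {F} (s : subst_t F) p : forall t u,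
  subt t p = Some u -> subt (subst s t) p = Some (subst s u).
Proof.
  induction p as [|i p IH]; intros t u; simpl; [now intros [= ->]|].
  destruct t as [x|f ts]; simpl; [discriminate|].
  rewrite nth_error_map. destruct (nth_error ts i); simpl; [apply IH|discriminate].
Qed.

Lemma nth_error_upd_nth_eq {A} (g : A -> A) i : forall ts,
  nth_error (upd_nth g i ts) i = option_map g (nth_error ts i).
Proof. induction i; intros [|t ts]; simpl; auto. Qed.

Lemma nth_error_upd_nth_neq {A} (g : A -> A) i : forall j ts, i <> j ->
  nth_error (upd_nth g i ts) j = nth_error ts j.
Proof. induction i; intros [|j] [|t ts]; simpl; auto; congruence. Qed.

Lemma parallel_cons i p q : parallel (i :: p) (i :: q) <-> parallel p q.
Proof.
  unfold parallel, prefix; split; intros [H1 H2]; split.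
  - intros [r ->]; apply H1; now exists r.
  - intros [r ->]; apply H2; now exists r.
  - intros [r [= Hr]]; apply H1; now exists r.
  - intros [r [= Hr]]; apply H2; now exists r.
Qed.

Lemma parallel_neq i j p q : i <> j -> parallel (i :: p) (j :: q).
Proof. intros H; split; intros [r [= Hr]]; congruence. Qed.

Lemma subt_repl_parallel {F} (u : term F) p : forall q t,
  parallel p q -> subt (repl t p u) q = subt t q.
Proof.
  induction p as [|i p IH]; intros q t H.
  - destruct H as [[] _]; now exists q.
  - destruct q as [|j q]; [destruct H as [_ []]; now exists (i :: p)|].
    destruct t as [x|f ts]; simpl; [auto|].
    destruct (Nat.eq_dec i j) as [<-|n].
    + rewrite nth_error_upd_nth_eq. destruct (nth_error ts i); simpl; [|auto].
      apply IH. now apply parallel_cons in H.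
    + now rewrite nth_error_upd_nth_neq.
Qed.

(** At a position below a variable of [t], [repl] leaves [t] alone but may act inside the instance;
    the side condition excludes this. *)
Lemma subst_repl {F} (s : subst_t F) u p : forall t,
  subt t p <> None -> subst s (repl t p u) = repl (subst s t) p (subst s u).
Proof.
  induction p as [|i p IH]; intros t H; simpl; [auto|].
  destruct t as [x|f ts]; simpl in *; [congruence|]. f_equal.
  revert i H. induction ts as [|t ts IHts]; intros [|i] H; simpl in *; auto; f_equal; auto.
Qed.

(** * Unification of linear terms *)

Fixpoint tsize {F} (t : term F) : nat :=
  match t with
  | Var _ _ => 1
  | Fun _ ts => S (list_sum (map tsize ts))
  end.

Lemma NoDup_app_inv {A} (l l' : list A) :
  NoDup (l ++ l') -> NoDup l /\ NoDup l' /\ (forall x, In x l -> ~ In x l').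
Proof.
  induction l as [|a l IH]; simpl; intros H.
  - repeat split; [constructor|auto|auto].
  - inversion H as [|? ? H1 H2]; subst. destruct (IH H2) as [N1 [N2 N3]].
    rewrite in_app_iff in H1. repeat split; auto.
    + constructor; tauto.
    + intros x [<-|Hx]; [tauto|auto].
Qed.

Lemma app_inj_length {A} (l1 l2 r1 r2 : list A) :
  length l1 = length l2 -> l1 ++ r1 = l2 ++ r2 -> l1 = l2 /\ r1 = r2.
Proof.
  revert l2; induction l1 as [|a l1 IH]; intros [|b l2]; simpl; intros H E;
    try discriminate; [auto|].
  injection H as H; injection E as -> E. destruct (IH _ H E) as [-> ->]; auto.
Qed.

(* Linearity makes an occurs check and the composition of partial solutions
   unnecessary: every variable is bound at most once. *)
Lemma linear_mgu {F} (n : nat) : forall (ls rs : list (term F)) (tau : subst_t F),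
  list_sum (map tsize ls) <= n ->
  NoDup (flat_map (@vars F) ls) -> NoDup (flat_map (@vars F) rs) ->
  vdisjoint (flat_map (@vars F) ls) (flat_map (@vars F) rs) ->
  map (subst tau) ls = map (subst tau) rs ->
  exists sigma : subst_t F,
    map (subst sigma) ls = map (subst sigma) rs /\
    (forall tau', map (subst tau') ls = map (subst tau') rs ->
       forall x, tau' x = subst tau' (sigma x)) /\
    (forall x, ~ In x (flat_map (@vars F) ls) -> ~ In x (flat_map (@vars F) rs) ->
       sigma x = Var F x).
Proof.
  induction n as [|n IH]; intros ls rs tau Hn Hl Hr Hlr Htau.
  { destruct ls as [|[x|f ts] ls]; simpl in Hn; [|lia|lia].
    destruct rs; [|discriminate]. exists (fun x => Var F x); repeat split; auto. }
  destruct ls as [|l ls]; destruct rs as [|r rs]; try discriminate.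
  { exists (fun x => Var F x); repeat split; auto. }
  simpl in *. injection Htau as Htau Htaus.
  assert (Hl' := Hl). assert (Hr' := Hr).
  apply NoDup_app_inv in Hl' as [Hl1 [Hl2 Hl3]].
  apply NoDup_app_inv in Hr' as [Hr1 [Hr2 Hr3]].
  assert (bind : forall x t,
    (l = Var F x /\ r = t) \/ (r = Var F x /\ l = t) -> exists sigma : subst_t F,
    subst sigma l :: map (subst sigma) ls = subst sigma r :: map (subst sigma) rs /\
    (forall tau', subst tau' l :: map (subst tau') ls = subst tau' r :: map (subst tau') rs ->
       forall x, tau' x = subst tau' (sigma x)) /\
    (forall x, ~ In x (vars l ++ flat_map (@vars F) ls) ->
       ~ In x (vars r ++ flat_map (@vars F) rs) -> sigma x = Var F x)).
  { intros x t Hx.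
    destruct (IH ls rs tau) as [sigma [S1 [S2 S3]]]; auto.
    { destruct l; simpl in Hn; lia. }
    { intros y Y1 Y2; apply (Hlr y); apply in_or_app; auto. }
    assert (Hxt : ~ In x (vars t) /\ ~ In x (flat_map (@vars F) ls) /\
      ~ In x (flat_map (@vars F) rs) /\
      forall y, In y (vars t) -> ~ In y (flat_map (@vars F) ls) /\ ~ In y (flat_map (@vars F) rs)).
    { unfold vdisjoint in Hlr; setoid_rewrite in_app_iff in Hlr.
      destruct Hx as [[-> <-]|[-> <-]]; simpl in *; firstorder. }
    destruct Hxt as [N1 [N2 [N3 N4]]].
    (* The solution [sigma] of the tails is extended by binding [x] to [t]. By linearity and
       disjointness [x] occurs neither in [t] nor in the tails, and [t] shares no variable with the
       tails, so [sigma] fixes [t]. *)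
    set (sg := fun y => if Nat.eq_dec y x then t else sigma y).
    assert (E : forall ts, ~ In x (flat_map (@vars F) ts) -> map (subst sg) ts = map (subst sigma) ts).
    { intros ts Hts; apply map_subst_ext; intros y Hy; unfold sg.
      destruct (Nat.eq_dec y x); congruence. }
    assert (Et : subst sg t = t).
    { rewrite <- (subst_Var t) at 2. apply subst_ext; intros y Hy; unfold sg.
      destruct (Nat.eq_dec y x); [congruence|]. now apply S3; apply N4. }
    assert (Ex : sg x = t) by (unfold sg; now destruct (Nat.eq_dec x x)).
    exists sg; repeat split.
    - f_equal; [|now rewrite !E].
      destruct Hx as [[-> ->]|[-> ->]]; simpl; congruence.
    - intros tau' [= T1 T2] y; unfold sg.
      destruct (Nat.eq_dec y x) as [->|]; [|auto].
      destruct Hx as [[-> ->]|[-> ->]]; simpl in *; congruence.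
    - intros y; rewrite !in_app_iff; intros Y1 Y2; unfold sg.
      destruct (Nat.eq_dec y x) as [->|]; [|apply S3; tauto].
      destruct Hx as [[-> ->]|[-> ->]]; simpl in *; tauto. }
  destruct l as [x|f ts]; [apply (bind x r); auto|].
  destruct r as [x|g us]; [apply (bind x (Fun f ts)); auto|].
  clear bind. simpl in Htau; injection Htau as <- Htau.
  assert (Hlen : length ts = length us).
  { rewrite <- (length_map (subst tau) ts), Htau; apply length_map. }
  simpl in *.
  (* Decomposition: the arguments join the remaining equations, and the loss of the head symbol
     lowers the size bound. *)
  destruct (IH (ts ++ ls) (us ++ rs) tau) as [sigma [S1 [S2 S3]]];
    rewrite ?flat_map_app; auto.
  { rewrite map_app, list_sum_app; lia. }
  { rewrite !map_app; congruence. }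
  exists sigma; repeat split.
  - rewrite !map_app in S1. apply app_inj_length in S1 as [-> ->]; [auto|].
    now rewrite !length_map.
  - intros tau' [= T1 T2]; apply S2. rewrite !map_app; congruence.
  - intros x; rewrite !flat_map_app in S3; apply S3.
Qed.

(** * Parallel rewriting *)

(** Parallel rewriting: redexes at pairwise parallel positions are contracted at once. Unlike in a
    multi-step, [par_root] rewrites nothing inside the matching substitution. *)
Inductive par {F} (S : trs F) : term F -> term F -> Prop :=
| par_var x : par S (Var F x) (Var F x)
| par_fun f ts us : Forall2 (par S) ts us -> par S (Fun f ts) (Fun f us)
| par_root l r s : S l r -> par S (subst s l) (subst s r).

Lemma par_refl {F} (S : trs F) t : par S t t.
Proof.
  induction t as [x|f ts IH] using term_args_ind; constructor.
  induction IH; constructor; auto.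
Qed.

Lemma par_subst {F} (S : trs F) (s s' : subst_t F) :
  (forall x, par S (s x) (s' x)) -> forall t, par S (subst s t) (subst s' t).
Proof.
  intros H t; induction t as [x|f ts IH] using term_args_ind; simpl; [auto|].
  constructor. induction IH; simpl; constructor; auto.
Qed.

Lemma rstep_par {F} (S : trs F) t u : rstep S t u -> par S t u.
Proof.
  induction 1; [now constructor|constructor].
  apply Forall2_app; [|constructor; auto];
    apply Forall2_impl with (R1 := eq); try (intros ? ? ->; apply par_refl);
    [induction ts1|induction ts2]; auto.
Qed.

Lemma rsteps_mono {F} (S R : trs F) :
  (forall l r, S l r -> R l r) -> forall t u, rsteps S t u -> rsteps R t u.
Proof.
  intros H. apply (clos_rt_lift (fun t => t)). intros t u Htu; apply rt_step.
  induction Htu; constructor; auto.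
Qed.

Lemma rsteps_ctx {F} (R : trs F) f ts1 ts2 t u :
  rsteps R t u -> rsteps R (Fun f (ts1 ++ t :: ts2)) (Fun f (ts1 ++ u :: ts2)).
Proof.
  apply (clos_rt_lift (fun t => Fun f (ts1 ++ t :: ts2))).
  intros; apply rt_step; now constructor.
Qed.

Lemma rsteps_args {F} (R : trs F) f ts us :
  Forall2 (rsteps R) ts us -> forall ts1, rsteps R (Fun f (ts1 ++ ts)) (Fun f (ts1 ++ us)).
Proof.
  induction 1 as [|t u ts us H _ IH]; intros ts1; [apply rt_refl|].
  eapply rt_trans; [apply rsteps_ctx, H|].
  specialize (IH (ts1 ++ [u])). now rewrite <- !app_assoc in IH.
Qed.

Lemma conv_args {F} (R : trs F) f ts us :
  Forall2 (conv R) ts us -> forall ts1, conv R (Fun f (ts1 ++ ts)) (Fun f (ts1 ++ us)).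
Proof.
  induction 1 as [|t u ts us H _ IH]; intros ts1; [apply rst_refl|].
  apply rst_trans with (Fun f (ts1 ++ u :: ts)).
  - revert H; apply (clos_rst_lift (fun t => Fun f (ts1 ++ t :: ts))).
    intros; now constructor.
  - specialize (IH (ts1 ++ [u])). now rewrite <- !app_assoc in IH.
Qed.

Lemma rstep_subst {F} (R : trs F) s t u : rstep R t u -> rstep R (subst s t) (subst s u).
Proof.
  induction 1; simpl; rewrite ?map_app; simpl; [rewrite !subst_subst|]; now constructor.
Qed.

Lemma rsteps_subst {F} (R : trs F) s t u : rsteps R t u -> rsteps R (subst s t) (subst s u).
Proof.
  apply (clos_rt_lift (subst s)); intros; apply rt_step; now apply rstep_subst.
Qed.

Lemma conv_subst {F} (R : trs F) s t u : conv R t u -> conv R (subst s t) (subst s u).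
Proof. apply (clos_rst_lift (subst s)); intros; now apply rstep_subst. Qed.

Lemma par_rsteps {F} (R : trs F) t : forall u, par R t u -> rsteps R t u.
Proof.
  induction t as [x|f ts IH] using term_args_ind; intros u H; inversion H; subst.
  - apply rt_refl.
  - now apply rt_step, rs_root.
  - apply (rsteps_args R f ts us) with (ts1 := []).
    match goal with H : Forall2 _ _ _ |- _ => clear -IH H; induction H end;
      inversion IH; constructor; auto.
  - now apply rt_step, rs_root.
Qed.

(** * Overlaps of a parallel step with a linear pattern *)

(** One redex that overlaps a pattern: [ov_pat] is the subterm of the pattern at [ov_pos], and the
    redex is the instance of [ov_lhs] by [ov_subst]. Each overlap has its own substitution because
    the rules are not yet renamed apart. *)
Record overlap (F : Type) := Overlap {
  ov_pos : pos; ov_pat : term F; ov_lhs : term F; ov_rhs : term F; ov_subst : subst_t F }.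
Arguments Overlap {F}. Arguments ov_pos {F}. Arguments ov_pat {F}.
Arguments ov_lhs {F}. Arguments ov_rhs {F}. Arguments ov_subst {F}.

Definition contract {F} (es : list (overlap F)) (t : term F) : term F :=
  fold_left (fun acc e => repl acc (ov_pos e) (subst (ov_subst e) (ov_rhs e))) es t.

Definition ov_move {F} (h : pos -> pos) (e : overlap F) : overlap F :=
  Overlap (h (ov_pos e)) (ov_pat e) (ov_lhs e) (ov_rhs e) (ov_subst e).

(** Re-indexes a position of [Fun f ts] for [Fun f (t :: ts)]. The root has no meaningful image and
    gets a default value. *)
Definition next_arg (p : pos) : pos :=
  match p with [] => [] | i :: q => S i :: q end.

Lemma contract_first_arg {F} f (ts : list (term F)) es : forall t,
  contract (map (ov_move (cons 0)) es) (Fun f (t :: ts)) = Fun f (contract es t :: ts).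
Proof. induction es as [|e es IH]; intros t; simpl; [auto|apply IH]. Qed.

Lemma contract_next_args {F} f (t : term F) es :
  Forall (fun e => ov_pos e <> []) es -> forall ts us,
  contract es (Fun f ts) = Fun f us ->
  contract (map (ov_move next_arg) es) (Fun f (t :: ts)) = Fun f (t :: us).
Proof.
  induction 1 as [|e es He _ IH]; intros ts us; simpl; [now intros [= ->]|].
  destruct (ov_pos e) as [|i q]; [congruence|]; simpl. apply IH.
Qed.

(** The last clause expresses parallelism: no other redex of the step lies below an overlap, so the
    variables there keep their values. *)
Definition ov_at {F} (S : trs F) (l : term F) (s s' : subst_t F) (e : overlap F) : Prop :=
  S (ov_lhs e) (ov_rhs e) /\ subt l (ov_pos e) = Some (ov_pat e) /\
  (exists f ts, ov_pat e = Fun f ts) /\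
  subst (ov_subst e) (ov_lhs e) = subst s (ov_pat e) /\
  (forall x, In x (vars (ov_pat e)) -> s' x = s x).

(* A parallel step from [subst s l] contracts the overlaps [es] at function
   positions of [l], and turns [s] into [s'] elsewhere. *)
Definition split_par {F} (S : trs F) (l : term F) (s : subst_t F) (t : term F)
    (es : list (overlap F)) (s' : subst_t F) : Prop :=
  ForallOrdPairs parallel (map ov_pos es) /\
  Forall (ov_at S l s s') es /\
  NoDup (flat_map (fun e => vars (ov_pat e)) es) /\
  incl (flat_map (fun e => vars (ov_pat e)) es) (vars l) /\
  (forall x, par S (s x) (s' x)) /\
  (forall x, ~ In x (vars l) -> s' x = s x) /\
  contract es (subst s' l) = t.

Lemma ForallOrdPairs_app {A} (P : A -> A -> Prop) l l' :
  ForallOrdPairs P l -> ForallOrdPairs P l' ->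
  (forall a b, In a l -> In b l' -> P a b) -> ForallOrdPairs P (l ++ l').
Proof.
  induction 1 as [|a l Ha Hl IH]; simpl; intros H' H; [auto|constructor].
  - apply Forall_app; split; [auto|apply Forall_forall; auto].
  - apply IH; auto.
Qed.

Lemma ForallOrdPairs_map {A B} (h : A -> B) (P : A -> A -> Prop) (Q : B -> B -> Prop) l :
  (forall a b, In a l -> In b l -> P a b -> Q (h a) (h b)) ->
  ForallOrdPairs P l -> ForallOrdPairs Q (map h l).
Proof.
  intros H; induction 1 as [|a l Ha Hl IH]; simpl; constructor.
  - apply Forall_map, Forall_forall; intros b Hb; apply H; simpl; auto.
    now apply (proj1 (Forall_forall _ _) Ha).
  - apply IH; intros; apply H; simpl; auto.
Qed.

(** The splittings of the arguments are assembled one argument at a time. That no overlap is at the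
    root is carried along so that [next_arg] is applied only to non-empty positions. *)
Lemma split_par_fun {F} (S : trs F) f s us : forall ts,
  Forall (fun l => forall t, NoDup (vars l) -> par S (subst s l) t ->
    exists es s', split_par S l s t es s') ts ->
  NoDup (flat_map (@vars F) ts) ->
  Forall2 (par S) (map (subst s) ts) us ->
  exists es s', split_par S (Fun f ts) s (Fun f us) es s' /\
    Forall (fun e => ov_pos e <> []) es.
Proof.
  induction us as [|u us IH]; intros ts HF Hnd HP; inversion HP as [|a b l1 l2 Hu Hus E]; subst.
  { apply eq_sym, map_eq_nil in H; subst. exists [], s; split; [|constructor].
    repeat split; try constructor; auto using par_refl. intros x []. }
  destruct ts as [|t ts]; [discriminate|]; injection E as -> ->.
  inversion HF as [|? ? Ht Hts]; subst. simpl in Hnd.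
  destruct (NoDup_app_inv _ _ Hnd) as [N1 [N2 N3]].
  destruct (Ht u N1 Hu) as [es1 [s1 [P1 [A1 [D1 [I1 [R1 [O1 C1]]]]]]]].
  destruct (IH ts Hts N2 Hus) as [es2 [s2 [[P2 [A2 [D2 [I2 [R2 [O2 C2]]]]]] Q2]]].
  simpl in I2, O2.
  (* Linearity separates the variables of [t] from those of [ts], so the two substitutions can be
     glued. *)
  set (s' := fun x => if in_dec Nat.eq_dec x (vars t) then s1 x else s2 x).
  assert (E1 : forall x, In x (vars t) -> s' x = s1 x).
  { intros x Hx; unfold s'; destruct (in_dec Nat.eq_dec x (vars t)); tauto. }
  assert (E2 : forall x, ~ In x (vars t) -> s' x = s2 x).
  { intros x Hx; unfold s'; destruct (in_dec Nat.eq_dec x (vars t)); tauto. }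
  assert (E2' : forall x, In x (flat_map (@vars F) ts) -> s' x = s2 x).
  { intros x Hx; apply E2; intros Hx'; now apply (N3 x). }
  assert (V : forall h (es : list (overlap F)),
    flat_map (fun e => vars (ov_pat e)) (map (ov_move h) es) =
    flat_map (fun e => vars (ov_pat e)) es).
  { intros h es; induction es; simpl; congruence. }
  exists (map (ov_move (cons 0)) es1 ++ map (ov_move next_arg) es2), s'.
  split.
  2:{ apply Forall_app; split; apply Forall_map; [apply Forall_forall; discriminate|].
      revert Q2; apply Forall_impl; intros e He; simpl. destruct (ov_pos e); [auto|discriminate]. }
  split; [|split; [|split; [|split; [|split; [|split]]]]].
  - rewrite map_app, !map_map.
    assert (M : forall h (es : list (overlap F)),
      map (fun e => ov_pos (ov_move h e)) es = map h (map ov_pos es))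
      by (intros; now rewrite map_map).
    rewrite !M. rewrite Forall_forall in Q2.
    assert (Q2' : forall p, In p (map ov_pos es2) -> p <> []).
    { intros p Hp; apply in_map_iff in Hp as [e [<- He]]; auto. }
    apply ForallOrdPairs_app.
    + revert P1; apply ForallOrdPairs_map; intros; now apply parallel_cons.
    + revert P2; apply ForallOrdPairs_map. intros p q Hp Hq H.
      apply Q2' in Hp, Hq. destruct p as [|i p], q as [|j q]; try congruence; simpl.
      destruct (Nat.eq_dec i j) as [->|n]; [|apply parallel_neq; congruence].
      apply parallel_cons in H; now apply parallel_cons.
    + intros p q Hp Hq. apply in_map_iff in Hp as [p' [<- _]].
      apply in_map_iff in Hq as [q' [<- Hq]]. apply Q2' in Hq.
      destruct q'; [congruence|]. now apply parallel_neq.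
  - apply Forall_app; split; apply Forall_map.
    + apply Forall_forall; intros e He.
      destruct (proj1 (Forall_forall _ _) A1 e He) as [H1 [H2 [H3 [H4 H5]]]].
      repeat split; auto. intros x Hx; simpl in Hx. rewrite E1; auto.
      apply I1, in_flat_map; eauto.
    + apply Forall_forall; intros e He.
      destruct (proj1 (Forall_forall _ _) A2 e He) as [H1 [H2 [H3 [H4 H5]]]].
      repeat split; auto.
      * rewrite Forall_forall in Q2; specialize (Q2 e He). simpl.
        destruct (ov_pos e); [congruence|auto].
      * intros x Hx; simpl in Hx. rewrite E2'; auto. apply I2, in_flat_map; eauto.
  - rewrite flat_map_app, !V. apply NoDup_app; auto.
    intros x X1 X2; apply I1 in X1; apply I2 in X2; now apply (N3 x).
  - rewrite flat_map_app, !V; simpl. apply incl_app_app; auto.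
  - intros x; unfold s'; destruct (in_dec Nat.eq_dec x (vars t)); auto.
  - simpl; intros x; rewrite in_app_iff; intros Hx. rewrite E2; [apply O2|]; tauto.
  - unfold contract; rewrite fold_left_app; simpl.
    fold (contract (map (ov_move (cons 0)) es1) (Fun f (subst s' t :: map (subst s') ts))).
    rewrite contract_first_arg, (subst_ext s' s1 t E1), C1, (map_subst_ext s' s2 ts E2').
    now apply contract_next_args.
Qed.

(** A variable occurs only once in [l], so rewriting below its occurrence is a change of the
    substitution. A root step is a single overlap at the empty position. *)
Lemma split_par_exists {F} (S : trs F) s l : forall t,
  NoDup (vars l) -> par S (subst s l) t -> exists es s', split_par S l s t es s'.
Proof.
  induction l as [x|f ts IH] using term_args_ind; intros t Hnd H.
  - exists [], (fun y => if Nat.eq_dec y x then t else s y).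
    split; [constructor|]. split; [constructor|]. split; [constructor|].
    split; [intros y []|]. split; [|split].
    + intros y; destruct (Nat.eq_dec y x) as [->|]; [exact H|apply par_refl].
    + simpl; intros y Hy; destruct (Nat.eq_dec y x) as [->|]; tauto.
    + simpl; now destruct (Nat.eq_dec x x).
  - simpl in H. inversion H as [|? ? us HP|l r th HS E]; subst.
    + destruct (split_par_fun S f s us ts IH Hnd HP) as [es [s' [H1 _]]]; eauto.
    + exists [Overlap [] (Fun f ts) l r th], s.
      split; [repeat constructor|]. split; [|split; [|split; [|split; [|split]]]]; auto.
      * constructor; [|constructor]. repeat split; simpl; eauto.
      * simpl; now rewrite app_nil_r.
      * simpl; rewrite app_nil_r; apply incl_refl.
      * intros; apply par_refl.
Qed.

(** A critical peak needs pairwise variable-disjoint variants. They are made one after the other,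
    away from a growing set [V], and a single [tau] then replaces all the matching substitutions. *)
Lemma rename_overlaps {F} (T : trs F) (es : list (overlap F)) :
  Forall (fun e => T (ov_lhs e) (ov_rhs e) /\ NoDup (vars (ov_lhs e))) es ->
  forall (V : list nat) (tau0 : subst_t F), exists (ps : list (pentry F)) (tau : subst_t F),
  (forall x, In x V -> tau x = tau0 x) /\
  Forall2 (fun e a => fst a = ov_pos e /\ variant_of T (fst (snd a)) (snd (snd a)) /\
    subst tau (fst (snd a)) = subst (ov_subst e) (ov_lhs e) /\
    subst tau (snd (snd a)) = subst (ov_subst e) (ov_rhs e) /\
    vdisjoint V (rule_vars (fst (snd a)) (snd (snd a)))) es ps /\
  ForallOrdPairs (fun a b => vdisjoint (rule_vars (fst (snd a)) (snd (snd a)))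
    (rule_vars (fst (snd b)) (snd (snd b)))) ps /\
  NoDup (flat_map (fun a => vars (fst (snd a))) ps).
Proof.
  induction 1 as [|e es [HS Hnd] _ IH]; intros V tau0.
  { exists [], tau0; repeat split; auto; constructor. }
  set (W := V ++ rule_vars (ov_lhs e) (ov_rhs e)).
  set (N := S (list_max W)).
  assert (HN : forall x, In x W -> x < N).
  { intros x Hx. assert (K := proj1 (list_max_le W (list_max W)) (le_n _)).
    rewrite Forall_forall in K. specialize (K x Hx). unfold N; lia. }
  (* the involution exchanging [0, N) with [N, 2N) *)
  set (h := fun x => if x <? N then x + N else if x <? 2 * N then x - N else x).
  assert (Hh : forall x, h (h x) = x).
  { intros x; unfold h. destruct (Nat.ltb_spec x N).
    - destruct (Nat.ltb_spec (x + N) N); [lia|]. destruct (Nat.ltb_spec (x + N) (2 * N)); lia.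
    - destruct (Nat.ltb_spec x (2 * N)).
      + destruct (Nat.ltb_spec (x - N) N); lia.
      + destruct (Nat.ltb_spec x N); [lia|]. destruct (Nat.ltb_spec x (2 * N)); lia. }
  assert (HhN : forall x, x < N -> h x = x + N).
  { intros x Hx; unfold h; destruct (Nat.ltb_spec x N); lia. }
  set (ren := subst (fun x => Var F (h x))).
  set (a := (ov_pos e, (ren (ov_lhs e), ren (ov_rhs e))) : pentry F).
  (* Below [N] lie the variables of [V]; from [N] on lie the shifted variables of the new rule, to
     be matched as before. The recursive call protects both, as the new variables are added to
     [V]. *)
  set (tau1 := fun x => if x <? N then tau0 x else ov_subst e (x - N)).
  destruct (IH (V ++ rule_vars (fst (snd a)) (snd (snd a))) tau1)
    as [ps [tau [T1 [T2 [T3 T4]]]]].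
  assert (ra : forall x, In x (rule_vars (fst (snd a)) (snd (snd a))) ->
    exists y, In y (rule_vars (ov_lhs e) (ov_rhs e)) /\ y < N /\ x = y + N).
  { intros x; unfold rule_vars; simpl; unfold ren. rewrite !vars_rename, <- map_app.
    intros Hx; apply in_map_iff in Hx as [y [<- Hy]].
    assert (y < N) by (apply HN; unfold W; apply in_or_app; right; exact Hy).
    exists y; repeat split; auto. }
  assert (Etau : forall t, incl (vars t) (rule_vars (ov_lhs e) (ov_rhs e)) ->
    incl (vars (ren t)) (rule_vars (fst (snd a)) (snd (snd a))) ->
    subst tau (ren t) = subst (ov_subst e) t).
  { intros t Ht Ht'. rewrite (subst_ext tau tau1).
    2:{ intros x Hx; apply T1, in_or_app; right; auto. }
    unfold ren; rewrite subst_subst. apply subst_ext; intros x Hx; simpl.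
    assert (x < N) by (apply HN, in_or_app; right; auto).
    rewrite HhN by auto. unfold tau1. destruct (Nat.ltb_spec (x + N) N); [lia|].
    f_equal; lia. }
  exists (a :: ps), tau; split; [|split; [|split]].
  - intros x Hx. rewrite T1 by (apply in_or_app; auto). unfold tau1.
    destruct (Nat.ltb_spec x N) as [|L]; [auto|].
    assert (x < N) by (apply HN, in_or_app; auto). lia.
  - constructor.
    + split; [auto|]. split; [|split; [|split]].
      * exists (ov_lhs e), (ov_rhs e); split; [auto|]. now exists h, h.
      * apply Etau; apply incl_appl, incl_refl.
      * apply Etau; apply incl_appr, incl_refl.
      * intros x Hx Hx'. destruct (ra x Hx') as [y [_ [Y1 Y2]]].
        assert (x < N) by (apply HN, in_or_app; auto). lia.
    + revert T2; apply Forall2_impl; intros e' a' [B1 [B2 [B3 [B4 B5]]]].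
      repeat split; auto. intros x Hx; apply B5, in_or_app; auto.
  - constructor; [|auto]. clear -T2.
    induction T2 as [|e' a' es' ps' [B1 [B2 [B3 [B4 B5]]]] _ IH]; constructor; auto.
    intros x Hx; apply B5, in_or_app; auto.
  - simpl; apply NoDup_app; auto.
    + unfold ren; rewrite vars_rename. apply Injective_map_NoDup; auto.
      intros x y E; rewrite <- (Hh x), E; auto.
    + intros x Hx Hx'. assert (Hxa : In x (rule_vars (fst (snd a)) (snd (snd a))))
        by (apply in_or_app; left; auto).
      clear -T2 Hxa Hx'. induction T2 as [|e' a' es' ps' [B1 [B2 [B3 [B4 B5]]]] _ IH]; [auto|].
      simpl in Hx'; apply in_app_or in Hx' as [Hx'|Hx']; [|auto].
      apply (B5 x); apply in_or_app; auto.
Qed.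

(** Translates the unification problem of a critical peak into the list form solved by
    [linear_mgu]. *)
Lemma unifies_iff {F} (l : term F) (es : list (overlap F)) (ps : list (pentry F)) :
  Forall2 (fun e a => fst a = ov_pos e /\ subt l (ov_pos e) = Some (ov_pat e)) es ps ->
  forall tau, unifies l ps tau <->
    map (subst tau) (map (fun a => fst (snd a)) ps) = map (subst tau) (map ov_pat es).
Proof.
  intros H tau; induction H as [|e a es ps [H1 H2] _ IH]; simpl.
  { split; [auto|intros _ a []]. }
  split.
  - intros U; f_equal.
    + apply (U a); [now left|congruence].
    + apply IH; intros b Hb; apply U; now right.
  - intros [= E1 E2] b [<-|Hb] s Hs; [|now apply (proj2 IH E2 b)]. congruence.
Qed.

(** Identifies the instance of a critical left result with the contracted term. Replacing at one
    position leaves the subterms at parallel positions intact, so every later position is still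
    present. *)
Lemma subst_contract {F} (sigma delta : subst_t F) es ps :
  Forall2 (fun e a => fst a = ov_pos e /\
    subst delta (subst sigma (snd (snd a))) = subst (ov_subst e) (ov_rhs e)) es ps ->
  ForallOrdPairs parallel (map ov_pos es) -> forall t,
  Forall (fun e => subt t (ov_pos e) <> None) es ->
  subst delta (fold_left (fun acc (a : pentry F) =>
    repl acc (fst a) (subst sigma (snd (snd a)))) ps t) = contract es (subst delta t).
Proof.
  induction 1 as [|e a es ps [H1 H2] _ IH]; simpl; intros HP t Ht; [auto|].
  inversion HP as [|? ? P1 P2]; inversion Ht as [|? ? T1 T2]; subst.
  rewrite IH; auto.
  - rewrite subst_repl, H1, H2; [auto|congruence].
  - rewrite Forall_map in P1. rewrite Forall_forall in *; intros e' He'.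
    rewrite subt_repl_parallel; [auto|]. rewrite H1; auto.
Qed.

(** * Local peaks of parallel steps *)

(** The two components are separate so that they combine argument by argument: joins modulo [C] are
    formed in all arguments, while a descent in one argument is enough for the whole term to
    descend. *)
Definition meets {F} (R C : trs F) (s t u : term F) : Prop :=
  (exists t1 u1, rsteps R t t1 /\ rsteps R u u1 /\ conv C t1 u1) /\
  (conv C t u \/ (rel_step (PCPS R C) R s t /\ rel_step (PCPS R C) R s u)).

Lemma meets_conv {F} (R C : trs F) s t u : conv C t u -> meets R C s t u.
Proof.
  intros H; split; [exists t, u; split; [|split]; [apply rt_refl|apply rt_refl|exact H]|now left].
Qed.

Lemma meets_sym {F} (R C : trs F) s t u : meets R C s t u -> meets R C s u t.
Proof.
  intros [[t1 [u1 [H1 [H2 H3]]]] H]; split.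
  - exists u1, t1; repeat split; auto. now apply rst_sym.
  - destruct H as [H|H]; [left; now apply rst_sym|tauto].
Qed.

Lemma rel_step_ctx {F} (P R : trs F) f ts1 us1 ts2 us2 t u :
  Forall2 (rsteps R) ts1 us1 -> rel_step P R t u -> Forall2 (rsteps R) ts2 us2 ->
  rel_step P R (Fun f (ts1 ++ t :: ts2)) (Fun f (us1 ++ u :: us2)).
Proof.
  intros H1 [t' [u' [A1 [A2 A3]]]] H2.
  exists (Fun f (ts1 ++ t' :: ts2)), (Fun f (ts1 ++ u' :: ts2)); split; [|split].
  - now apply rsteps_ctx.
  - now constructor.
  - apply (rsteps_args R f (ts1 ++ u' :: ts2) (us1 ++ u :: us2)) with (ts1 := []).
    apply Forall2_app; [|constructor]; auto.
Qed.

(** The left step is split along [l]. Without overlaps it happens inside the substitution and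
    commutes with the root step; with overlaps the peak, after the substitution part, is an instance
    of a parallel critical peak. *)
Lemma par_peak_root {F} (R C S1 S2 : trs F) l r s t :
  is_trs R -> left_linear R ->
  (forall l r, S1 l r -> R l r) -> (forall l r, S2 l r -> R l r) ->
  (forall s t u, pc_peak R s t u -> joinable R t u) ->
  S2 l r -> par S1 (subst s l) t ->
  exists t' u', par S2 t t' /\ par S1 (subst s r) u' /\ meets R C (subst s l) t' u'.
Proof.
  intros HR HL HS1 HS2 HJ Hlr Ht.
  assert (Nl : NoDup (vars l)) by (eapply HL; eauto).
  destruct (split_par_exists S1 s l t Nl Ht)
    as [es [s' [P1 [A1 [D1 [I1 [R1 [O1 C1]]]]]]]].
  destruct es as [|e0 es0] eqn:Ees.
  { simpl in C1; subst t. exists (subst s' r), (subst s' r); split; [|split].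
    - now constructor.
    - now apply par_subst.
    - apply meets_conv, rst_refl. }
  rewrite <- Ees in *. assert (Hes : es <> []) by (rewrite Ees; discriminate). clear Ees.
  set (V := rule_vars l r).
  destruct (rename_overlaps S1 es) with (V := V) (tau0 := s)
    as [ps [tau [T1 [T2 [T3 T4]]]]].
  { revert A1; apply Forall_impl; intros e [H _]; split; [auto|]. eapply HL; eauto. }
  assert (Vl : forall x, In x (vars l) -> In x V) by (intros; apply in_or_app; auto).
  assert (Vr : forall x, In x (vars r) -> In x V) by (intros; apply in_or_app; auto).
  (* [tau] describes the source of the peak, [tau1] the same term after the part of the left step
     inside the substitution. *)
  set (tau1 := fun x => if in_dec Nat.eq_dec x V then s' x else tau x).
  assert (F1 : forall x, In x V -> tau1 x = s' x).
  { intros x Hx; unfold tau1; destruct (in_dec Nat.eq_dec x V); tauto. }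
  assert (F2 : forall x, ~ In x V -> tau1 x = tau x).
  { intros x Hx; unfold tau1; destruct (in_dec Nat.eq_dec x V); tauto. }
  assert (Rtau : forall x, par S1 (tau x) (tau1 x)).
  { intros x; unfold tau1; destruct (in_dec Nat.eq_dec x V) as [Hx|]; [|apply par_refl].
    now rewrite T1. }
  assert (El : subst s l = subst tau l) by (symmetry; apply subst_ext; auto).
  assert (Er : subst s r = subst tau r) by (symmetry; apply subst_ext; auto).
  assert (El1 : subst s' l = subst tau1 l) by (symmetry; apply subst_ext; auto).
  assert (HU : Forall2 (fun e a => fst a = ov_pos e /\ subt l (ov_pos e) = Some (ov_pat e)) es ps).
  { clear -T2 A1; induction T2 as [|e a es ps [B _] _ IH]; constructor;
      inversion A1 as [|? ? [_ [K _]] L]; subst; auto. }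
  assert (HU' := unifies_iff l es ps HU).
  assert (Dps : forall a, In a ps -> vdisjoint V (rule_vars (fst (snd a)) (snd (snd a)))).
  { clear -T2; induction T2 as [|e a es ps [_ [_ [_ [_ B]]]] _ IH]; intros b;
      [intros []|intros [<-|Hb]; auto]. }
  assert (Utau : map (subst tau) (map (fun a => fst (snd a)) ps)
    = map (subst tau) (map ov_pat es)).
  { assert (Hin : forall x, In x (flat_map (fun e => vars (ov_pat e)) es) -> tau x = s x) by auto.
    clear -T2 A1 Hin.
    induction T2 as [|e a es ps [_ [_ [B _]]] _ IH]; simpl in *; [auto|].
    inversion A1 as [|? ? [_ [_ [_ [K _]]]] L]; subst. f_equal.
    - rewrite B, K; symmetry; apply subst_ext; intros; apply Hin, in_or_app; auto.
    - apply IH; auto; intros; apply Hin, in_or_app; auto. }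
  (* [tau1] still unifies: the renamed rules have no variable in [V], and [s'] agrees with [s] on
     the variables below overlaps. *)
  assert (Utau1 : map (subst tau1) (map (fun a => fst (snd a)) ps)
    = map (subst tau1) (map ov_pat es)).
  { transitivity (map (subst tau) (map (fun a => fst (snd a)) ps));
      [|rewrite Utau]; rewrite !map_map; apply map_ext_in.
    - intros a Ha; apply subst_ext; intros x Hx; apply F2; intros HV.
      apply (Dps a Ha x HV); apply in_or_app; auto.
    - intros e He; apply subst_ext; intros x Hx.
      assert (In x (vars l)) by (apply I1, in_flat_map; eauto).
      rewrite F1, T1 by auto. rewrite Forall_forall in A1.
      destruct (A1 e He) as [_ [_ [_ [_ K]]]]; symmetry; auto. }
  assert (FM : forall A B (h : A -> B) (k : B -> list nat) xs,
    flat_map k (map h xs) = flat_map (fun x => k (h x)) xs).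
  { intros A B h k xs; induction xs; simpl; congruence. }
  destruct (linear_mgu _ (map (fun a => fst (snd a)) ps) (map ov_pat es) tau (le_n _)) as [sigma [M1 [M2 _]]];
    rewrite ?FM; auto.
  { intros x Hx Hx'. apply in_flat_map in Hx as [a [Ha Hx]].
    apply (Dps a Ha x); [auto|apply in_or_app; auto]. }
  (* A root overlap of a rule with its own variant is not critical. Matching determines the
     variables of [l], hence those of [r], so both contracta coincide. *)
  destruct (classic (exists le re, ps = [([], (le, re))] /\ is_variant le re l r))
    as [[le [re [-> [h [_ [_ [_ [Hle Hre]]]]]]]]|Hnv].
  { inversion T2 as [|e ? ? ? [B1 [_ [B2 [B3 _]]]] T2']; subst.
    inversion T2'; subst. simpl in *.
    inversion HU as [|? ? ? ? [_ K] _]; subst. rewrite <- B1 in *; simpl in K.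
    injection K as K.
    exists (subst s r), (subst s r); split; [|split; [apply par_refl|apply meets_conv, rst_refl]].
    replace (subst s r) with (subst (ov_subst e) (ov_rhs e)); [apply par_refl|].
    injection Utau as Utau. rewrite <- B3, Er, subst_subst. apply subst_ext.
    rewrite subst_subst, <- K in Utau. intros x Hx.
    apply (subst_ext_inv _ _ l Utau). now apply (HR l r); auto. }
  set (s0 := subst sigma l).
  set (t0 := fold_left (fun acc (a : pentry F) => repl acc (fst a) (subst sigma (snd (snd a))))
    ps (subst sigma l)).
  set (u0 := subst sigma r).
  assert (PC : pc_peak R s0 t0 u0).
  { exists l, r, ps, sigma. split; [|split; [|split; [|split; [|split; [|split; [|split]]]]]]; auto.
    - exists l, r; split; [auto|]. exists (fun x => x), (fun x => x).
      rewrite !subst_Var; auto.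
    - intros ->; inversion T2; subst; auto.
    - replace (map fst ps) with (map ov_pos es).
      + clear -P1; induction P1 as [|p l H1 H2 IH]; constructor; auto.
        intros Hp; rewrite Forall_forall in H1. destruct (H1 p Hp) as [[] _].
        exists []; now rewrite app_nil_r.
      + clear -HU; induction HU as [|e a es ps [H _] _ IH]; simpl; congruence.
    - intros a Ha; split; [|split; [|auto]].
      + clear -T2 Ha HS1. induction T2 as [|e b es ps [_ [B _]] _ IH]; [destruct Ha|].
        destruct Ha as [<-|Ha]; [|auto]. destruct B as [l' [r' [B1 B2]]].
        exists l', r'; auto.
      + clear -HU A1 Ha. induction HU as [|e b es ps [B B'] _ IH]; [destruct Ha|].
        inversion A1 as [|? ? [_ [_ [[f [ts K]] _]]] L]; subst.
        destruct Ha as [<-|Ha]; [|auto]. exists f, ts; congruence.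
    - assert (P1' : ForallOrdPairs (fun a b : pentry F => parallel (fst a) (fst b) /\
        vdisjoint (rule_vars (fst (snd a)) (snd (snd a)))
          (rule_vars (fst (snd b)) (snd (snd b)))) ps).
      { replace (map ov_pos es) with (map fst ps) in P1.
        - clear -T3 P1. induction T3 as [|a ps H1 H2 IH]; constructor;
            simpl in P1; inversion P1 as [|? ? Q1 Q2]; subst; auto.
          rewrite Forall_map in Q1. rewrite Forall_forall in *; auto.
        - clear -HU; induction HU as [|e a es ps [H _] _ IH]; simpl; congruence. }
      intros a b Ha Hb Hab.
      destruct (ForallOrdPairs_In P1' a b Ha Hb) as [E|[E|[[E1 E1'] E2]]]; [congruence|auto|].
      split; [split; auto|]. intros x X1 X2; now apply (E2 x).
    - split; [now apply HU'|]. intros tau' Htau'; exists tau'. apply M2; now apply HU'.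
    - intros le re E Hv; apply Hnv; eauto. }
  (* As [tau1] unifies, composing it with [sigma] gives [tau1] back; hence [tau1] itself
     instantiates the critical peak to the concrete terms. *)
  assert (Es0 : subst tau1 s0 = subst tau1 l).
  { unfold s0; rewrite subst_subst. apply subst_ext; intros; symmetry; now apply M2. }
  assert (Eu0 : subst tau1 u0 = subst tau1 r).
  { unfold u0; rewrite subst_subst. apply subst_ext; intros; symmetry; now apply M2. }
  assert (Et0 : subst tau1 t0 = t).
  { unfold t0; rewrite subst_contract with (es := es); auto.
    - fold s0. now rewrite Es0, <- El1.
    - assert (M3 : forall t, subst tau1 (subst sigma t) = subst tau1 t).
      { intros v; rewrite subst_subst; apply subst_ext; intros; symmetry; now apply M2. }
      clear -T2 Dps M3 F2. induction T2 as [|e a es ps [B1 [_ [_ [B2 _]]]] _ IH]; constructor.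
      + split; [auto|]. rewrite M3, <- B2. apply subst_ext; intros x Hx; apply F2; intros HV.
        apply (Dps a (or_introl eq_refl) x HV); apply in_or_app; auto.
      + apply IH; intros; apply Dps; now right.
    - revert A1; apply Forall_impl; intros e [_ [K _]].
      rewrite (subt_subst sigma _ _ _ K); discriminate. }
  (* The left side stays put; the right side catches up with the substitution part of the left
     step. *)
  exists t, (subst tau1 r); split; [apply par_refl|split; [rewrite Er; now apply par_subst|]].
  destruct (classic (conv C t0 u0)) as [Hc|Hc].
  { apply meets_conv. rewrite <- Et0, <- Eu0. now apply conv_subst. }
  (* The instance of the critical source is only a reduct of the actual source; the leading [R]
     steps of [rel_step] bridge the gap. *)
  assert (Hs : rsteps R (subst s l) (subst tau1 s0)).
  { rewrite Es0, El. apply (rsteps_mono S1 R HS1), par_rsteps, par_subst, Rtau. }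
  assert (HP : forall v, v = t0 \/ v = u0 ->
    rel_step (PCPS R C) R (subst s l) (subst tau1 v)).
  { intros v Hv; exists (subst tau1 s0), (subst tau1 v); split; [auto|]; split; [|apply rt_refl].
    apply rs_root. exists t0, u0; auto. }
  destruct (HJ _ _ _ PC) as [v [J1 J2]].
  rewrite <- Et0, <- Eu0; split.
  - exists (subst tau1 v), (subst tau1 v); repeat split; try (now apply rsteps_subst).
    apply rst_refl.
  - right; split; apply HP; auto.
Qed.

(** If either step is at the root, the root case applies, with sides exchanged if necessary;
    otherwise the arguments are closed separately. [S1] and [S2] are kept apart because both [R]
    against [R] and [C] against [R] are needed. *)
Lemma par_peak {F} (R C S1 S2 : trs F) :
  is_trs R -> left_linear R ->
  (forall l r, S1 l r -> R l r) -> (forall l r, S2 l r -> R l r) ->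
  (forall s t u, pc_peak R s t u -> joinable R t u) ->
  forall s t u, par S1 s t -> par S2 s u ->
  exists t' u', par S2 t t' /\ par S1 u u' /\ meets R C s t' u'.
Proof.
  intros HR HL HS1 HS2 HJ s.
  induction s as [x|f ss IH] using term_args_ind; intros t u Ht Hu.
  - inversion Hu as [y E|f ts us H E|l r s Hlr E]; subst.
    + exists t, t; split; [apply par_refl|split; [auto|apply meets_conv, rst_refl]].
    + rewrite <- E in *. eapply par_peak_root; eauto.
  - inversion Hu as [y E|f' ts us Hus E|l r s Hlr E]; subst.
    2:{ rewrite <- E in *. eapply par_peak_root; eauto. }
    inversion Ht as [y E|f' ts' ts Hts E|l r s Hlr E]; subst.
    2:{ rewrite <- E in *.
        destruct (par_peak_root R C S2 S1 l r s _ HR HL HS2 HS1 HJ Hlr Hu)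
          as [u' [t' [H1 [H2 H3]]]].
        exists t', u'; repeat split; auto; apply meets_sym in H3; apply H3. }
    (* The induction runs over the argument list. The descent is stated for every prefix [qs] of
       further reducing arguments, so that it survives adding arguments on the left. *)
    assert (K : exists ts' us', Forall2 (par S2) ts ts' /\ Forall2 (par S1) us us' /\
      Forall2 (rsteps R) ss ts' /\ Forall2 (rsteps R) ss us' /\
      (exists ts1 us1, Forall2 (rsteps R) ts' ts1 /\ Forall2 (rsteps R) us' us1 /\
         Forall2 (conv C) ts1 us1) /\
      (Forall2 (conv C) ts' us' \/
       forall qs qs', Forall2 (rsteps R) qs qs' ->
         rel_step (PCPS R C) R (Fun f (qs ++ ss)) (Fun f (qs' ++ ts')) /\
         forall qs', Forall2 (rsteps R) qs qs' ->
         rel_step (PCPS R C) R (Fun f (qs ++ ss)) (Fun f (qs' ++ us')))).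
    { clear Ht Hu. revert ts us Hts Hus.
      induction IH as [|s ss Hs _ IHss]; intros ts us Hts Hus;
        inversion Hts as [|? t ? ts0 A1 A2]; inversion Hus as [|? u ? us0 B1 B2]; subst.
      { exists [], []; repeat split; try constructor. exists [], []; repeat split; constructor.
        constructor. }
      destruct (Hs _ _ A1 B1) as [t' [u' [H1 [H2 [[t1 [u1 [J1 [J2 J3]]]] H3]]]]].
      destruct (IHss _ _ A2 B2)
        as [ts' [us' [G1 [G2 [G3 [G4 [[ts1 [us1 [K1 [K2 K3]]]] G5]]]]]]].
      assert (st : rsteps R s t').
      { eapply rt_trans; eapply rsteps_mono; [|apply par_rsteps, A1| |apply par_rsteps, H1]; auto. }
      assert (su : rsteps R s u').
      { eapply rt_trans; eapply rsteps_mono; [|apply par_rsteps, B1| |apply par_rsteps, H2]; auto. }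
      exists (t' :: ts'), (u' :: us').
      split; [constructor; auto|]. split; [constructor; auto|].
      split; [constructor; auto|]. split; [constructor; auto|]. split.
      { exists (t1 :: ts1), (u1 :: us1); repeat split; constructor; auto. }
      destruct H3 as [H3|[H3 H3']].
      (* If the head argument is only convertible, a descent must come from a later one; the head is
         then moved into the prefix. *)
      - destruct G5 as [G5|G5]; [left; constructor; auto|right].
        intros qs qs' Hq.
        assert (app1 : forall a (b : list (term F)) c, a ++ c :: b = (a ++ [c]) ++ b)
          by (intros; now rewrite <- app_assoc).
        rewrite (app1 qs ss s), (app1 qs' ts' t').
        destruct (G5 (qs ++ [s]) (qs' ++ [t'])) as [G6 G7].
        { apply Forall2_app; auto. }
        split; [auto|]. intros qs1 Hq1; rewrite (app1 qs1 us' u'). apply G7.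
        apply Forall2_app; auto.
      - right; intros qs qs' Hq; split; [|intros qs1 Hq1]; now apply rel_step_ctx. }
    destruct K as [ts' [us' [G1 [G2 [G3 [G4 [[ts1 [us1 [K1 [K2 K3]]]] G5]]]]]]].
    exists (Fun f ts'), (Fun f us'); split; [now constructor|]; split; [now constructor|].
    split.
    + exists (Fun f ts1), (Fun f us1); split; [|split];
        [apply (rsteps_args R f _ _ K1 [])|apply (rsteps_args R f _ _ K2 [])|
         apply (conv_args C f _ _ K3 [])].
    + destruct G5 as [G5|G5]; [left; apply (conv_args C f _ _ G5 [])|right].
      destruct (G5 [] [] (Forall2_nil _)) as [G6 G7]. split; [exact G6|].
      apply (G7 [] (Forall2_nil _)).
Qed.

(** * Confluence by well-founded induction on relative rewriting *)

Theorem theorem11 (F : Type) (R C : trs F) :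
  is_trs R -> left_linear R ->
  is_trs C -> (forall l r, C l r -> R l r) -> confluent C ->
  (forall s t u, pc_peak R s t u -> joinable R t u) ->
  rel_terminating (PCPS R C) R ->
  confluent R.
Proof.
  intros HR HL _ HC Cconf HJ HT.
  assert (WF := no_chain_Acc _ HT).
  intros a; specialize (WF a); induction WF as [a _ IH]; intros t u Ht Hu.
  set (low := rel_step (PCPS R C) R a).
  set (base := fun s t => rstep C s t \/ (low s /\ rstep R s t)).
  assert (CR : forall s t, rsteps C s t -> rsteps R s t) by now apply rsteps_mono.
  (* Relative steps absorb trailing [R] steps, so any [R] reduction from a [low] term is also a
     [base] reduction. *)
  assert (low_R : forall s t, low s -> rsteps R s t -> low t).
  { intros s v [x [y [H1 [H2 H3]]]] H; exists x, y; repeat split; auto.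
    eapply rt_trans; eauto. }
  assert (base_R : forall s t, clos_refl_trans _ base s t -> rsteps R s t).
  { apply (clos_rt_lift (fun t => t)). intros x y [H|[_ H]]; [|now apply rt_step].
    apply CR; now apply rt_step. }
  assert (C_base : forall s t, rsteps C s t -> clos_refl_trans _ base s t).
  { apply (clos_rt_lift (fun t => t)). intros x y H; apply rt_step; now left. }
  assert (conv_base : forall s t, conv C s t -> clos_refl_sym_trans _ base s t).
  { apply (clos_rst_lift (fun t => t)). intros x y H; now left. }
  assert (low_base : forall s t, low s -> rsteps R s t -> clos_refl_trans _ base s t).
  { intros s v Hs H; apply clos_rt_rt1n in H.
    induction H as [s|s x v H H' IH']; [apply rt_refl|].
    eapply rt_trans; [apply rt_step; right; eauto|].
    apply IH'. apply (low_R s); [auto|now apply rt_step]. }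
  assert (low_joins : forall s t u, low s -> rsteps R s t -> rsteps R s u -> joins base t u).
  { intros s v w Hs Hv Hw. destruct (IH s Hs v w Hv Hw) as [z [Z1 Z2]].
    exists z; split; apply low_base; eauto. }
  (* Cutting a [base] reduction at its first step from a [low] term leaves a [C] reduction followed
     by an [R] reduction among [low] terms. *)
  assert (base_split : forall s t, clos_refl_trans _ base s t ->
    exists l, rsteps C s l /\ (l = t \/ (low l /\ rsteps R l t))).
  { intros s v H; apply clos_rt_rt1n in H; induction H as [s|s x v [H|[H1 H2]] H' [l [L1 L2]]].
    - exists s; split; [apply rt_refl|auto].
    - exists l; split; [|auto]. eapply rt_trans; [apply rt_step|]; eauto.
    - exists s; split; [apply rt_refl|right; split; [auto|]].
      eapply rt_trans; [apply rt_step; eauto|]. apply base_R. now apply clos_rt1n_rt. }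
  assert (base_confluent : forall s t u,
    clos_refl_trans _ base s t -> clos_refl_trans _ base s u -> joins base t u).
  { intros s v w Hv Hw.
    destruct (base_split _ _ Hv) as [lv [V1 V2]]. destruct (base_split _ _ Hw) as [lw [W1 W2]].
    destruct (Cconf s lv lw V1 W1) as [z [Z1 Z2]].
    (* Each end is joined with the [C] join [z]. A side that needs the induction hypothesis makes
       [z] itself [low], so [z1] and [z2], both reducts of [z], can be joined again. *)
    assert (side : forall l v z, rsteps C l z -> l = v \/ (low l /\ rsteps R l v) ->
      exists z', clos_refl_trans _ base v z' /\ clos_refl_trans _ base z z' /\
        (z' = z \/ low z)).
    { intros l v' z' Hz [->|[L1 L2]].
      - exists z'; split; [auto|split; [apply rt_refl|auto]].
      - destruct (low_joins l v' z') as [k [K1 K2]]; auto.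
        exists k; split; [auto|split; [auto|right; eauto]]. }
    destruct (side lv v z Z1 V2) as [z1 [A1 [A2 A3]]].
    destruct (side lw w z Z2 W2) as [z2 [B1 [B2 B3]]].
    assert (J : joins base z1 z2).
    { destruct A3 as [->|A3]; [exists z2; split; [auto|apply rt_refl]|].
      apply (low_joins z); auto. }
    destruct J as [k [K1 K2]]; exists k; split; eapply rt_trans; eauto. }
  set (X := rsteps R a).
  (* A descent from a reduct of [a] is one from [a], so both ends are [low] and their closing [R]
     reductions become [base] reductions. *)
  assert (meets_base : forall s t u, X s -> meets R C s t u -> clos_refl_sym_trans _ base t u).
  { intros s v w Hs [[v1 [w1 [H1 [H2 H3]]]] [H|[[x [y [L1 L2]]] [x' [y' [L1' L2']]]]]]; [auto|].
    assert (low v /\ low w) as [Lv Lw].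
    { split; [exists x, y|exists x', y']; (split; [eapply rt_trans; eauto|auto]). }
    apply rst_trans with v1; [apply clos_rt_clos_rst; auto|].
    apply rst_trans with w1; [auto|apply rst_sym, clos_rt_clos_rst; auto]. }
  assert (step_par : forall s t, rsteps R s t -> clos_refl_trans _ (par R) s t).
  { apply (clos_rt_lift (fun t => t)). intros; apply rt_step; now apply rstep_par. }
  destruct (confluent_modulo (par R) base X) with (x := a) (y := t) (z := u)
    as [v [V1 V2]]; auto.
  - intros x y Hx H; eapply rt_trans; [exact Hx|now apply par_rsteps].
  - intros x y Hx H; eapply rt_trans; [exact Hx|]. apply base_R; now apply rt_step.
  - intros x y z Hx Hy Hz.
    destruct (par_peak R C R R HR HL) with (s := x) (t := y) (u := z)
      as [y' [z' [H1 [H2 H3]]]]; eauto 10.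
  - intros x y z Hx [Hy|[L Hy]] Hz.
    (* The closing step from [z] is a parallel [C] step, which the conversion absorbs. *)
    + destruct (par_peak R C C R HR HL) with (s := x) (t := y) (u := z)
        as [y' [z' [H1 [H2 H3]]]]; auto.
      { now apply rstep_par. }
      exists y'; split; [auto|]. apply rst_trans with z'; [eauto|].
      apply rst_sym, clos_rt_clos_rst, C_base. now apply par_rsteps.
    (* Below [a] the induction hypothesis joins [y] and [z], so an empty parallel step from [y]
       suffices. *)
    + exists y; split; [apply par_refl|]. apply joins_conv, (low_joins x); auto.
      * now apply rt_step.
      * now apply par_rsteps.
  - apply rt_refl.
  - assert (red : forall s t, clos_refl_trans _ (union _ (par R) base) s t -> rsteps R s t).
    { apply (clos_rt_lift (fun t => t)). intros x y [H|H]; [now apply par_rsteps|].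
      apply base_R; now apply rt_step. }
    exists v; split; apply red; auto.
Qed.
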